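(* Let $(f_n)_{n\in\mathbb{N}}$ be a subexponential sequence in $\mathscr{F}$ such that for every $n\in\mathbb{N}$ the linear endomorphism $L_n:=f_n^1$ of $\mathbb{C}^d$ is invertible, lower triangular, and such that $$\|L_{n,m}\|\le c\,\lambda^{n-m},\qquad \|L_{n,m}^{-1}\|\le c\,\mu^{n-m},\qquad \forall n\ge m\ge0,$$ where $c>0$ and $0<\lambda<1<\mu$. Let $m_0$ be a positive integer such that $\lambda^{m_0+1}\mu<1$. Assume that the vector $(\lambda_n(1),\dots,\lambda_n(d))$ of diagonal entries of $L_n$ satisfies the following condition: for every $\theta>1$ there exists a positive number $C(\theta)$ such that $$\max_{1\le h\le d}|\lambda_{n+\ell,n}(h)|\ \max_{1\le i\le j\le d}\frac{|\lambda_{n+\ell,n}(j)|}{|\lambda_{n+\ell,n}(i)|}\le C(\theta)\,\theta^n\,\lambda^\ell\qquad\forall n,\ell\in\mathbb{N}.$$ Then there exist a subexponential sequence $(g_n)_{n\in\mathbb{N}}$ of special triangular automorphisms of $\mathbb{C}^d$ of degree at most $m_0$ and a subexponential sequence $(h_n)_{n\in\mathbb{N}}$ in $\mathscr{F}$ such that $g_n^1=L_n$, $h_n^1=I$, and $$h_{n+1}\circ f_n=g_n\circ h_n\qquad\forall n\in\mathbb{N}$$ as formal series.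
   Context: $\mathbb{N}=\{0,1,2,\dots\}$. $\mathbb{C}^d$ is endowed with the norm $|z|=\max_j|z_j|$, and $\|\cdot\|$ is the induced operator norm on linear endomorphisms. $\mathscr{H}^k$ is the space of homogeneous polynomial maps $p\colon\mathbb{C}^d\to\mathbb{C}^d$ of degree $k$, normed by $\|p\|=\sup_{|z|\leq 1}|p(z)|$. $\mathscr{F}\subset\mathbb{C}[[z_1,\dots,z_d]]^d$ is the space of $d$-component formal power series in $d$ variables with vanishing zero order term. Each $f\in\mathscr{F}$ is written uniquely as $f=\sum_{k\ge1}f^k$ with $f^k\in\mathscr{H}^k$ its $k$-homogeneous part; $\circ$ is formal composition. Polynomial maps vanishing at $0$ are regarded as elements of $\mathscr{F}$. A sequence $(u_n)$ in a finite dimensional normed space is subexponential if for every $\theta>1$ there is $A>0$ with $|u_n|\le A\theta^n$ for all $n\ge0$. A sequence $(f_n)\subset\mathscr{F}$ is subexponential if for every $k\ge1$ the sequence $(f_n^k)_n\subset\mathscr{H}^k$ is subexponential. For $n\ge m\ge0$: $L_{n,m}=L_{n-1}L_{n-2}\cdots L_m$, $L_{n,n}=I$; similarly $\lambda_{n,m}(j)=\prod_{k=m}^{n-1}\lambda_k(j)$, with $\lambda_{n,n}(j)=1$. A special triangular automorphism of $\mathbb{C}^d$ is a polynomial map $g$ of the form $g_1(z)=\lambda_1z_1$, $g_j(z)=\lambda_jz_j+h_j(z_1,\dots,z_{j-1})$ for $2\le j\le d$, where all $\lambda_j\ne0$ and each $h_j$ is a polynomial in $z_1,\dots,z_{j-1}$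 vanishing at the origin. *)

(* Defs.v *)
From HB Require Import structures.
From mathcomp Require Import all_boot all_order all_algebra.
From mathcomp Require Import complex mpoly.
From mathcomp Require Import boolp classical_sets reals.

Set Implicit Arguments.
Unset Strict Implicit.
Unset Printing Implicit Defensive.

Import Order.TTheory GRing.Theory Num.Theory.
Import Normc.

Local Open Scope ring_scope.
Local Open Scope complex_scope.
Local Open Scope classical_set_scope.

Section Norms.
Variables (R : realType) (d : nat).

Definition vnorm (z : 'cV[R[i]]_d) : R := \big[Num.max/0]_(j < d) normc (z j 0).

Definition opnorm (A : 'M[R[i]]_d) : R :=
  sup [set vnorm (A *m z) | z in [set z | vnorm z <= 1]].

Definition polymap : Type := 'I_d -> {mpoly R[i][d]}.

Definition peval (p : polymap) (z : 'cV[R[i]]_d) : 'cV[R[i]]_d :=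
  \col_j (p j).@[fun i => z i 0].

(* The set is nonempty and bounded, so [sup] is a genuine supremum; see
   [pnorm_has_sup]. *)
Definition pnorm (p : polymap) : R :=
  sup [set vnorm (peval p z) | z in [set z | vnorm z <= 1]].

End Norms.

Section FormalSeries.
Variables (R : realType) (d : nat).

(* Elements of C[[z_1, ..., z_d]]^d: [f j m] is the coefficient of the monomial
   z^m in the j-th component. *)
Definition fseries : Type := 'I_d -> 'X_{1..d} -> R[i].

Definition in_F (f : fseries) : Prop := forall j, f j 0%MM = 0.

Definition ftrunc (N : nat) (f : fseries) : polymap R d :=
  fun j => \sum_(m : 'X_{1..d < N.+1}) f j m *: 'X_[m].

Definition hpart (k : nat) (f : fseries) : polymap R d :=
  fun j => \sum_(m : 'X_{1..d < k.+1} | mdeg m == k) f j m *: 'X_[m].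

Definition fseries_of_polymap (p : polymap R d) : fseries := fun j m => (p j)@_m.

(* The matrix of the 1-homogeneous part; see [peval_hpart1]. *)
Definition linpart (f : fseries) : 'M[R[i]]_d := \matrix_(i, j) f i U_(j)%MM.

(* Formal composition f o g for g without constant term: the coefficient of z^m
   only involves the terms of f and g of degree at most |m|, hence can be read
   off the composition of the truncations; see [fcomp_trunc]. *)
Definition fcomp (f g : fseries) : fseries := fun j m =>
  (ftrunc (mdeg m) f j \mPo [tuple ftrunc (mdeg m) g i | i < d])@_m.

End FormalSeries.

Section Sequences.
Variables (R : realType) (d : nat).

Definition subexponential (f : nat -> fseries R d) : Prop :=
  forall k, (1 <= k)%N -> forall theta : R, 1 < theta ->
  exists2 A : R, 0 < A & forall n, pnorm (hpart k (f n)) <= A * theta ^+ n.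

(* L_{n,m} = L_{n-1} L_{n-2} ... L_m for n >= m, with decreasing indices. *)
Definition mprod (L : nat -> 'M[R[i]]_d) (n m : nat) : 'M[R[i]]_d :=
  \prod_(k <- rev (index_iota m n)) L k.

Definition dprod (L : nat -> 'M[R[i]]_d) (n m : nat) (j : 'I_d) : R[i] :=
  \prod_(m <= k < n) L k j j.

(* For the first component, [h] below has no variable available and vanishes
   at the origin, hence is 0. *)
Definition special_triangular (g : polymap R d) : Prop :=
  exists (lam : 'I_d -> R[i]) (h : polymap R d), forall j : 'I_d,
    [/\ lam j != 0,
        g j = lam j *: 'X_j + h j,
        (h j)@_0%MM = 0
      & forall m, m \in msupp (h j) -> forall i : 'I_d, (j <= i)%N -> m i = 0%N].

Definition degree_le (g : polymap R d) (m0 : nat) : Prop :=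
  forall j, (msize (g j) <= m0.+1)%N.

End Sequences.

Section Theory.
Variables (R : realType) (d : nat).
Implicit Types (f g : fseries R d).

Lemma mcoeff_ftrunc N f j m :
  (ftrunc N f j)@_m = if (mdeg m <= N)%N then f j m else 0.
Proof.
rewrite /ftrunc raddf_sum /=.
have [mN|mN] := leqP (mdeg m) N.
  have mN' : (mdeg m < N.+1)%N by [].
  rewrite (bigD1 (BMultinom mN')) //= mcoeffZ mcoeffX eqxx mulr1 big1 ?addr0//.
  move=> i /negPf im; rewrite mcoeffZ mcoeffX.
  by move: im; rewrite bmeqP /= => ->; rewrite mulr0.
rewrite big1 // => i _; rewrite mcoeffZ mcoeffX.
case: eqP => [im|_]; last by rewrite mulr0.
by move: (bmdeg i); rewrite im ltnS leqNgt mN.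
Qed.

Lemma mcoeff_hpart k f j m :
  (hpart k f j)@_m = if mdeg m == k then f j m else 0.
Proof.
rewrite /hpart raddf_sum /=.
have [mk|mk] := eqVneq (mdeg m) k.
  have mk' : (mdeg m < k.+1)%N by rewrite mk.
  rewrite (bigD1 (BMultinom mk')) /= ?mk// mcoeffZ mcoeffX eqxx mulr1 big1 ?addr0//.
  move=> i /andP[_ /negPf im]; rewrite mcoeffZ mcoeffX.
  by move: im; rewrite bmeqP /= => ->; rewrite mulr0.
rewrite big1 // => i /eqP ik; rewrite mcoeffZ mcoeffX.
case: eqP => [im|_]; last by rewrite mulr0.
by move: mk; rewrite -im ik eqxx.
Qed.

Lemma peval_hpart1 f z : peval (hpart 1 f) z = linpart f *m z.
Proof.
apply/colP => j; rewrite !mxE.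
have -> : hpart 1 f j = \sum_(i < d) f j U_(i)%MM *: 'X_i.
  apply/mpolyP => m; rewrite mcoeff_hpart raddf_sum /=.
  have [/mdeg1P/= [i /eqP ->]|m1] := boolP (mdeg m == 1%N).
    rewrite (bigD1 i) //= mcoeffZ mcoeffX eqxx mulr1 big1 ?addr0//.
    by move=> k /negPf ki; rewrite mcoeffZ mcoeffX eq_mnm1 ki mulr0.
  rewrite big1 // => i _; rewrite mcoeffZ mcoeffX.
  case: eqP => [im|_]; last by rewrite mulr0.
  by move: m1; rewrite -im mdeg1.
rewrite raddf_sum; apply: eq_bigr => i _.
by rewrite /= mevalZ mevalXU !mxE.
Qed.

Lemma ler_vnorm (z : 'cV[R[i]]_d) (b : R) :
  0 <= b -> (forall j, normc (z j 0) <= b) -> vnorm z <= b.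
Proof. by move=> b0 zb; apply: bigmax_le => // j _; apply: zb. Qed.

Lemma normc_le_vnorm (z : 'cV[R[i]]_d) j : normc (z j 0) <= vnorm z.
Proof. exact: (le_bigmax _ (fun j => normc (z j 0))). Qed.

Lemma ler_normc_sum (I : Type) (r : seq I) (P : pred I) (F : I -> R[i]) :
  normc (\sum_(i <- r | P i) F i) <= \sum_(i <- r | P i) normc (F i).
Proof.
elim/big_rec2: _ => [|i a b _ ab]; first by rewrite normc0.
exact: le_trans (le_normcD _ _) (lerD (lexx _) ab).
Qed.

Lemma normc_ge0 (x : R[i]) : 0 <= normc x.
Proof. by case: x => a b; apply: sqrtr_ge0. Qed.

Lemma vnorm0 : vnorm (0 : 'cV[R[i]]_d) = 0.
Proof.
by apply/eqP; rewrite eq_le ler_vnorm ?bigmax_ge_id// => j; rewrite mxE normc0.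
Qed.

Lemma pnorm_has_sup (p : polymap R d) :
  has_sup [set vnorm (peval p z) | z in [set z | vnorm z <= 1]].
Proof.
split; first by exists (vnorm (peval p 0)); exists 0 => //=; rewrite vnorm0 ler01.
exists (\sum_j \sum_(m <- msupp (p j)) normc (p j)@_m) => _ [z /= z1 <-].
apply: ler_vnorm => [|j].
  by apply: sumr_ge0 => j _; apply: sumr_ge0 => m _; apply: normc_ge0.
rewrite (bigD1 j) //= -[leLHS]addr0; apply: lerD; last first.
  by apply: sumr_ge0 => k _; apply: sumr_ge0 => m _; apply: normc_ge0.
rewrite mxE mevalE; apply: le_trans (ler_normc_sum _ _ _) _.
apply: ler_sum => m _; rewrite normcM ler_piMr ?normc_ge0//.
elim/big_ind: _ => [|x y x1 y1|i _]; first by rewrite normc1.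
  by rewrite normcM mulr_ile1 ?normc_ge0.
elim: (m i) => [|n IH]; first by rewrite expr0 normc1.
rewrite exprS normcM mulr_ile1 ?normc_ge0//.
exact: le_trans (normc_le_vnorm _ _) z1.
Qed.

Lemma opnorm_linpart f : opnorm (linpart f) = pnorm (hpart 1 f).
Proof.
congr sup; apply/seteqP; split=> _ [z z1 <-]; exists z => //;
  by rewrite peval_hpart1.
Qed.

Definition ord_ge k (p : {mpoly R[i][d]}) : Prop :=
  forall m, (mdeg m < k)%N -> p@_m = 0.

Lemma ord_geM k l p q : ord_ge k p -> ord_ge l q -> ord_ge (k + l) (p * q).
Proof.
move=> pk ql m mkl; rewrite mcoeffM big1 // => -[/= a b] /eqP mab.
have [ak|ka] := ltnP (mdeg a) k; first by rewrite pk ?mul0r.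
rewrite (ql b) ?mulr0 // -(ltn_add2l k); apply: leq_ltn_trans mkl.
by rewrite [X in (_ <= mdeg X)%N]mab mdegD leq_add2r.
Qed.

Lemma ord_geX k p n : ord_ge k p -> ord_ge (n * k) (p ^+ n).
Proof.
move=> pk; elim: n => [|n IH]; first by move=> m; rewrite mul0n.
by rewrite exprS mulSn; apply: ord_geM.
Qed.

Lemma ord_ge_mon (g : polymap R d) (m : 'X_{1..d}) :
  (forall i, ord_ge 1 (g i)) -> ord_ge (mdeg m) (\prod_(i < d) g i ^+ m i).
Proof.
move=> g1; rewrite mdegE; elim/big_rec2: _ => [m'|i p k _ IH]; first by [].
by apply: ord_geM => //; rewrite -{1}(muln1 (m i)); apply: ord_geX.
Qed.

Lemma ord_ge_subM k p p' q q' : ord_ge k (p - p') -> ord_ge k (q - q') ->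
  ord_ge k (p * q - p' * q').
Proof.
move=> pk qk m mk; have -> : p * q - p' * q' = (p - p') * q + p' * (q - q').
  by rewrite mulrBl mulrBr addrA subrK.
rewrite mcoeffD (ord_geM (l := 0) pk) ?addn0//.
by rewrite (ord_geM (k := 0) _ qk) ?addr0.
Qed.

Lemma fcomp_trunc f g N M j m : in_F g -> (mdeg m <= N)%N -> (mdeg m <= M)%N ->
  (ftrunc N f j \mPo [tuple ftrunc M g i | i < d])@_m = fcomp f g j m.
Proof.
move=> g0 mN mM.
have key N' M' : (mdeg m <= N')%N -> (mdeg m <= M')%N ->
    (ftrunc N' f j \mPo [tuple ftrunc M' g i | i < d])@_m =
    \sum_(a : 'X_{1..d < (mdeg m).+1})
      f j a * (\prod_(i < d) ftrunc (mdeg m) g i ^+ a i)@_m.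
  move=> mN' mM'; rewrite [LHS](_ : _ =
    \sum_(a : 'X_{1..d < N'.+1}) f j a * (\prod_(i < d) ftrunc M' g i ^+ a i)@_m).
    rewrite (bigID (fun a : 'X_{1..d < N'.+1} => (mdeg a <= mdeg m)%N)) /=.
    rewrite [X in _ + X]big1 ?addr0; last first.
      move=> a; rewrite -ltnNge => ma; rewrite (ord_ge_mon _ ma) ?mulr0 // => i b.
      rewrite ltnS leqn0 mdeg_eq0 => /eqP ->.
      by rewrite mcoeff_ftrunc mdeg0 leq0n g0.
    have mN1 : (mdeg m < N'.+1)%N by [].
    rewrite (reindex (fun a : 'X_{1..d < (mdeg m).+1} =>
      BMultinom (leq_trans (bmdeg a) mN1))) /=; last first.
      exists (fun a : 'X_{1..d < N'.+1} => insubd (@bm0 d (mdeg m)) (bmnm a)).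
        by move=> a _; apply/val_inj; rewrite val_insubd /= bmdeg.
      by move=> a am; apply/val_inj; rewrite /= val_insubd ltnS (am : (mdeg a <= mdeg m)%N = true).
    apply: eq_big => [a|a _]; first by rewrite -ltnS bmdeg.
    congr (_ * _); apply/eqP; rewrite -subr_eq0 -mcoeffB.
    apply/eqP; suff : ord_ge (mdeg m).+1 (\prod_(i < d) ftrunc M' g i ^+ a i -
        \prod_(i < d) ftrunc (mdeg m) g i ^+ a i) by apply.
    apply: (big_ind2 (fun p q => ord_ge (mdeg m).+1 (p - q))) => [b _|p p' q q'|i _].
    - by rewrite subrr mcoeff0.
    - exact: ord_ge_subM.
    - elim: (bmnm a i) => [|n IH]; first by move=> b _; rewrite !expr0 subrr mcoeff0.
      rewrite !exprS; apply: ord_ge_subM => // b; rewrite ltnS => bm.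
      by rewrite mcoeffB !mcoeff_ftrunc bm (leq_trans bm mM') subrr.
  set lq := [tuple _ | i < d]; rewrite /ftrunc.
  rewrite (big_morph _ (comp_mpolyD lq) (comp_mpoly0 lq)).
  rewrite (big_morph _ (mcoeffD m) (mcoeff0 _ m)); apply: eq_bigr => a _ /=.
  rewrite comp_mpolyZ mcoeffZ comp_mpolyX; congr (_ * _@__).
  by apply: eq_bigr => i _; rewrite tnth_mktuple.
rewrite (key _ _ mN mM).
by rewrite -(key _ _ (leqnn _) (leqnn _)).
Qed.

End Theory.

(* Main.v *)
Require Import Defs.
From HB Require Import structures.
From mathcomp Require Import all_boot all_order all_algebra.
From mathcomp Require Import complex mpoly.
From mathcomp Require Import boolp classical_sets reals.
From mathcomp Require Import zify ring lra.

Set Implicit Arguments.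
Unset Strict Implicit.
Unset Printing Implicit Defensive.

Import Order.TTheory GRing.Theory Num.Theory.
Import Normc.

Local Open Scope ring_scope.
Local Open Scope complex_scope.

(** Comparing coefficients turns the conjugacy equation
    [h_(n+1) o f_n = g_n o h_n] into scalar equations, one for each component
    [j] and each multi-index [m] with [|m| > 1]:
    [lambda_n(j) x_n - lambda_n^m x_(n+1) + y_n = r_n],
    where [x_n] and [y_n] are the coefficients of [z^m] in the [j]-th components
    of [h_n] and [g_n], and [r_n] only involves coefficients which come earlier
    in a suitable order. Since [L_n] is lower triangular, composing with it
    moves indices of variables downwards, and multiplying by it moves indices of
    components upwards; hence the order is by degree, then by a weight for which
    variables of small index are heavy, then by component. It is encoded by the
    number [rank j m], and [residual_sub] is the scalar equation.

    If [m] has degree at most [m0] and only involves variables of index smaller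
    than [j], then [z^m] is allowed in the [j]-th component of a special
    triangular map: put [x = 0] and [y = r]. Otherwise put [y = 0] and solve for
    [x] forward in time,
    [x_n = sum_l (prod_(n <= k < n + l) lambda_k^m / lambda_k(j))
                 r_(n+l) / lambda_(n+l)(j)].
    This series converges to a subexponential sequence ([solveP],
    [solve_subexp]) as soon as the product over [l] steps is at most
    [C theta^n rho^l], with [rho < 1] fixed and [theta > 1] arbitrary. There are
    two reasons for such a bound. If [|m| > m0], the numerator is of order
    [lambda^(l |m|)] and the denominator at least of order [mu^(-l)], whence
    [rho = lambda^(m0+1) mu] ([quotient_dominated_deg]). If some variable [z_i]
    with [j <= i] occurs in [z^m], the ratio [lambda(i) / lambda(j)] and one
    more factor [lambda(h)] of the numerator are controlled by the hypothesis on
    the diagonal entries, whence [rho = lambda] ([quotient_dominated_var]).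

    The scalar argument needs subexponential coefficients instead of
    subexponential norms of homogeneous parts. The two notions agree because a
    coefficient of a polynomial is a fixed linear combination of values at
    finitely many points of the unit polydisc ([mcoeff_le_pnorm]). *)

(** * Series dominated by a geometric series *)

Section Summation.
Variable R : realType.
Implicit Types (u : nat -> R) (z : nat -> R[i]) (K q : R) (N : nat).

Lemma le0_geometric (y K q : R) : 0 <= q -> q < 1 ->
  (forall N, y <= K * q ^+ N) -> y <= 0.
Proof.
move=> q0 q1 yKq; rewrite leNgt; apply/negP => y0.
have K0 : 0 < K by apply: lt_le_trans y0 _; rewrite -[K]mulr1 -(expr0 q).
have [q_eq0|q_neq0] := eqVneq q 0.
  by have := yKq 1%N; rewrite q_eq0 expr1 mulr0 leNgt y0.
have q_gt0 : 0 < q by rewrite lt0r q_neq0.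
pose e := q^-1 - 1.
have e0 : 0 < e by rewrite subr_gt0 invf_gt1.
(* Bernoulli's inequality makes the powers of the inverse of [q] unbounded. *)
have bern N : 1 + N%:R * e <= (q ^+ N)^-1.
  rewrite -exprVn -[q^-1](subrK 1) -/e; elim: N => [|N IH].
    by rewrite mul0r addr0 expr0.
  rewrite exprS; apply: le_trans (_ : (e + 1) * (1 + N%:R * e) <= _).
    rewrite -natr1; have : 0 <= N%:R * e * e by rewrite !mulr_ge0 // ltW.
    nra.
  by rewrite ler_pM2l // addr_gt0.
have B0 : 0 <= K / (y * e) by rewrite divr_ge0 ?mulr_ge0 ?ltW.
have := archi_boundP B0; set N := Num.Def.archi_bound _.
rewrite ltr_pdivrMr ?mulr_gt0 // => KN.
have := yKq N; rewrite -ler_pdivrMr ?exprn_gt0 // => yN.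
have := bern N => /(ler_wpM2l (ltW y0)) bN.
have := le_trans bN yN; nra.
Qed.

(** The lower limit of the partial sums: a formula for the sum of a series which
    does not involve the rate of convergence, so that several geometric bounds
    can be used for the same series. *)
Definition rsum u : R :=
  sup [set x | exists N, forall M, (N <= M)%N -> x <= \sum_(l < M) u l]%classic.

Lemma sum_tail u K q N M : 0 <= q -> q < 1 ->
  (forall l, `|u l| <= K * q ^+ l) -> (N <= M)%N ->
  `|\sum_(l < M) u l - \sum_(l < N) u l| <= K / (1 - q) * (q ^+ N - q ^+ M).
Proof.
move=> q0 q1 uKq; have q1' : 1 - q != 0 by rewrite subr_eq0 gt_eqF.
elim: M => [|M IH]; first by rewrite leqn0 => /eqP->; rewrite !subrr mulr0 normr0.
rewrite leq_eqVlt => /orP[/eqP->|]; first by rewrite !subrr mulr0 normr0.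
rewrite ltnS => /IH {}IH; rewrite big_ord_recr /= addrAC.
apply: le_trans (ler_normD _ _) _; apply: le_trans (lerD IH (uKq M)) _.
rewrite le_eqVlt; apply/orP; left; apply/eqP; rewrite exprS; field.
exact: q1'.
Qed.

Lemma rsumP u K q N : 0 <= q -> q < 1 -> (forall l, `|u l| <= K * q ^+ l) ->
  `|rsum u - \sum_(l < N) u l| <= K / (1 - q) * q ^+ N.
Proof.
move=> q0 q1 uKq.
have K0 : 0 <= K by rewrite -[K]mulr1 -(expr0 q); apply: le_trans (uKq 0%N).
have D0 : 0 <= K / (1 - q) by rewrite divr_ge0 // subr_ge0 ltW.
have tail N' M : (N' <= M)%N ->
    `|\sum_(l < M) u l - \sum_(l < N') u l| <= K / (1 - q) * q ^+ N'.
  move=> NM; apply: le_trans (sum_tail q0 q1 uKq NM) _.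
  by rewrite ler_wpM2l // lerBlDr lerDl exprn_ge0.
pose E := [set x | exists N, forall M, (N <= M)%N -> x <= \sum_(l < M) u l]%classic.
(* The intervals with centre the N-th partial sum and radius the N-th tail
   bound all contain the sum. *)
have ubE N' : ubound E (\sum_(l < N') u l + K / (1 - q) * q ^+ N').
  move=> x [P Px]; apply: le_trans (Px (maxn P N') (leq_maxl _ _)) _.
  have := tail N' (maxn P N') (leq_maxr _ _); rewrite ler_norml => /andP[_]; lra.
have inE N' : E (\sum_(l < N') u l - K / (1 - q) * q ^+ N').
  by exists N' => M /tail; rewrite ler_norml => /andP[+ _]; lra.
have supE : has_sup E by split; eexists; [exact: (inE 0%N)|exact: (ubE 0%N)].
have := ge_sup supE.1 (ubE N); have := sup_upper_bound supE (inE N).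
rewrite -[sup E]/(rsum u) => lo hi; rewrite ler_norml; apply/andP; split; lra.
Qed.

Definition csum z : R[i] := rsum (fun l => complex.Re (z l)) +i* rsum (fun l => complex.Im (z l)).

Lemma normr_Re_le (z : R[i]) : `|complex.Re z| <= normc z.
Proof.
case: z => a b /=; rewrite -sqrtr_sqr ler_wsqrtr //.
by rewrite lerDl sqr_ge0.
Qed.

Lemma normr_Im_le (z : R[i]) : `|complex.Im z| <= normc z.
Proof.
case: z => a b /=; rewrite -sqrtr_sqr ler_wsqrtr //.
by rewrite lerDr sqr_ge0.
Qed.

Lemma normc_le_ReIm (z : R[i]) : normc z <= `|complex.Re z| + `|complex.Im z|.
Proof.
case: z => a b /=; rewrite -[leRHS]ger0_norm ?addr_ge0 // -sqrtr_sqr.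
rewrite ler_wsqrtr // sqrrD !real_normK ?num_real // lerD2r lerDl.
by rewrite mulrn_wge0 // mulr_ge0.
Qed.

Lemma csumP z K q N : 0 <= q -> q < 1 -> (forall l, normc (z l) <= K * q ^+ l) ->
  normc (csum z - \sum_(l < N) z l) <= 2 * (K / (1 - q)) * q ^+ N.
Proof.
move=> q0 q1 zKq; apply: le_trans (normc_le_ReIm _) _.
have -> : csum z - \sum_(l < N) z l =
    (rsum (fun l => complex.Re (z l)) - \sum_(l < N) complex.Re (z l)) +i*
    (rsum (fun l => complex.Im (z l)) - \sum_(l < N) complex.Im (z l)).
  by rewrite -(raddf_sum (@complex.Re R)) -(raddf_sum (@complex.Im R)); case: (\sum_(l < N) z l).
rewrite /= -mulrA mulr_natl mulr2n; apply: lerD; apply: rsumP => // l.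
  exact: le_trans (normr_Re_le _) (zKq l).
exact: le_trans (normr_Im_le _) (zKq l).
Qed.

Lemma csum_bound z K q : 0 <= q -> q < 1 -> (forall l, normc (z l) <= K * q ^+ l) ->
  normc (csum z) <= 2 * (K / (1 - q)).
Proof.
by move=> q0 q1 /(csumP 0 q0 q1); rewrite big_ord0 subr0 expr0 mulr1.
Qed.

(** Both sides are approximated by the same partial sums, up to a geometric error. *)
Lemma csum_shift (z z' : nat -> R[i]) (w : R[i]) K q : 0 <= q -> q < 1 ->
  (forall l, normc (z l) <= K * q ^+ l) -> (forall l, normc (z' l) <= K * q ^+ l) ->
  (forall l, z l.+1 = w * z' l) -> csum z = z 0%N + w * csum z'.
Proof.
move=> q0 q1 zKq z'Kq zz'; apply/eqP; rewrite -subr_eq0; apply/eqP/eq0_normc.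
apply/eqP; rewrite eq_le normc_ge0 andbT.
apply: (@le0_geometric _ (2 * (K / (1 - q)) * q + normc w * (2 * (K / (1 - q)))) q) => // N.
have -> : csum z - (z 0%N + w * csum z') = (csum z - \sum_(l < N.+1) z l) +
    - (w * (csum z' - \sum_(l < N) z' l)).
  have zw : \sum_(l < N) z (lift ord0 l) = w * \sum_(l < N) z' l.
    by rewrite mulr_sumr; apply: eq_bigr => l _; apply: zz'.
  by rewrite big_ord_recl zw; ring.
apply: le_trans (le_normcD _ _) _; rewrite normcN normcM mulrDl; apply: lerD.
  by rewrite -mulrA -exprS; apply: csumP.
by rewrite -[leRHS]mulrA ler_wpM2l ?normc_ge0 //; apply: csumP.
Qed.
End Summation.

(** * Subexponential scalar sequences and the scalar equation *)

Section ScalarSequences.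
Variable R : realType.
Implicit Types (u v : nat -> R[i]) (theta : R).

Definition subexp u : Prop := forall theta, 1 < theta ->
  exists2 A : R, 0 < A & forall n, normc (u n) <= A * theta ^+ n.

Lemma subexp_ge1 (theta : R) n : 1 < theta -> 1 <= theta ^+ n.
Proof. by move=> /ltW; apply: exprn_ege1. Qed.

Lemma subexp_cst (a : R[i]) : subexp (fun=> a).
Proof.
move=> theta t1; exists (normc a + 1) => [|n]; first by rewrite ltr_wpDl ?normc_ge0.
have := subexp_ge1 n t1; have := normc_ge0 a; nra.
Qed.

Lemma subexpD u v : subexp u -> subexp v -> subexp (fun n => u n + v n).
Proof.
move=> su sv theta t1; have [A A0 uA] := su _ t1; have [B B0 vB] := sv _ t1.
exists (A + B) => [|n]; first by rewrite addr_gt0.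
by apply: le_trans (le_normcD _ _) _; rewrite mulrDl lerD.
Qed.

Lemma subexpN u : subexp u -> subexp (fun n => - u n).
Proof.
by move=> su theta t1; have [A A0 uA] := su _ t1; exists A => // n; rewrite normcN.
Qed.

Lemma subexpM u v : subexp u -> subexp v -> subexp (fun n => u n * v n).
Proof.
move=> su sv theta t1.
have s1 : 1 < Num.sqrt theta by rewrite -sqrtr1 ltr_sqrt // (lt_trans ltr01).
have [A A0 uA] := su _ s1; have [B B0 vB] := sv _ s1.
exists (A * B) => [|n]; first by rewrite mulr_gt0.
rewrite normcM; apply: le_trans (ler_pM _ _ (uA n) (vB n)) _; rewrite ?normc_ge0 //.
rewrite mulrACA -exprMn -expr2 sqr_sqrtr //.
by apply: ltW; apply: lt_trans t1.
Qed.

Lemma subexp_sum (I : Type) (r : seq I) (P : pred I) (F : I -> nat -> R[i]) :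
  (forall i, subexp (F i)) -> subexp (fun n => \sum_(i <- r | P i) F i n).
Proof.
move=> sF; elim: r => [|i r IH].
  by have := subexp_cst 0; congr subexp; apply/funext => n; rewrite big_nil.
case: (boolP (P i)) => Pi.
  by have := subexpD (sF i) IH; congr subexp; apply/funext => n; rewrite big_cons Pi.
by move: IH; congr subexp; apply/funext => n; rewrite big_cons (negPf Pi).
Qed.

Lemma subexp_shift u : subexp u -> subexp (fun n => u n.+1).
Proof.
move=> su theta t1; have [A A0 uA] := su _ t1.
exists (A * theta) => [|n]; first by rewrite mulr_gt0 // (lt_trans ltr01).
by rewrite -mulrA -exprS.
Qed.

Definition solve_term (a b r : nat -> R[i]) n l : R[i] :=
  (\prod_(n <= k < n + l) (b k / a k)) * (r (n + l)%N / a (n + l)%N).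

(** The solution of [a n * x n - b n * x n.+1 = r n] obtained by iterating
    [x n = (r n + b n * x n.+1) / a n] forward in time. *)
Definition solve a b r n : R[i] := csum (solve_term a b r n).

Section Solve.
Variables (a b r : nat -> R[i]) (K rho : R).
Hypothesis a_neq0 : forall n, a n != 0.
Hypothesis K_gt0 : 0 < K.
Hypothesis aK : forall n, normc (a n)^-1 <= K.
Hypothesis rho_ge0 : 0 <= rho.
Hypothesis rho_lt1 : rho < 1.
Hypothesis ba_rho : forall theta, 1 < theta -> exists2 C : R, 0 < C &
  forall n l, normc (\prod_(n <= k < n + l) (b k / a k)) <= C * theta ^+ n * rho ^+ l.
Hypothesis r_subexp : subexp r.

(** The growth of [r] is absorbed by the rate [rho]: a factor [tau ^+ (n + l)] with
    [tau] close to 1 costs [tau ^+ n], which is harmless, and changes the ratio of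
    the series from [rho] to [rho * tau], which is still smaller than 1. *)
Lemma solve_term_bound theta : 1 < theta ->
  exists q : R, [/\ 0 <= q, q < 1 & exists2 D : R, 0 < D &
    forall n l, normc (solve_term a b r n l) <= D * theta ^+ n * q ^+ l].
Proof.
move=> t1; have t0 := lt_trans ltr01 t1.
(* A base whose square is at most theta and which does not spoil the rate rho. *)
pose tau := Num.min (Num.sqrt theta) (2 / (1 + rho)).
have s1 : 1 < Num.sqrt theta by rewrite -sqrtr1 ltr_sqrt.
have rho1 : 0 < 1 + rho by apply: ltr_wpDr.
have tau1 : 1 < tau by rewrite lt_min s1 /= ltr_pdivlMr //; move: rho_lt1; rewrite mul1r; lra.
have tau0 := lt_trans ltr01 tau1.
have tau2 : tau * tau <= theta.
  rewrite -[leRHS](sqr_sqrtr (ltW t0)) expr2.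
  by rewrite ler_pM ?ge_min ?lexx // ltW.
have rt1 : rho * tau < 1.
  apply: le_lt_trans (_ : rho * (2 / (1 + rho)) < 1).
    by rewrite ler_wpM2l // ge_min lexx orbT.
  by rewrite mulrA ltr_pdivrMr // mul1r; move: rho_lt1; lra.
have [C C0 baC] := ba_rho tau1; have [A A0 rA] := r_subexp tau1.
exists (rho * tau); split => //; first by rewrite mulr_ge0 // ltW.
exists (C * (A * K)) => [|n l]; first by rewrite !mulr_gt0.
rewrite /solve_term !normcM.
apply: le_trans (_ : C * tau ^+ n * rho ^+ l * (A * tau ^+ (n + l) * K) <= _).
  by rewrite !ler_pM ?mulr_ge0 ?normc_ge0.
apply: le_trans (_ : C * (A * K) * (tau * tau) ^+ n * (rho * tau) ^+ l <= _).
  by rewrite !exprMn exprD le_eqVlt; apply/orP; left; apply/eqP; ring.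
rewrite ler_wpM2r ?exprn_ge0 ?mulr_ge0 //; try exact: ltW.
rewrite ler_wpM2l ?mulr_ge0 //; try exact: ltW.
by rewrite lerXn2r ?nnegrE ?mulr_ge0 // ltW.
Qed.

Lemma solve_subexp : subexp (solve a b r).
Proof.
move=> theta /solve_term_bound[q [q0 q1 [D D0 tD]]].
exists (2 * (D / (1 - q))) => [|n]; first by rewrite mulr_gt0 // divr_gt0 // subr_gt0.
apply: le_trans (csum_bound q0 q1 (tD n)) _.
by rewrite le_eqVlt; apply/orP; left; apply/eqP; ring.
Qed.

Lemma solveP n : a n * solve a b r n - b n * solve a b r n.+1 = r n.
Proof.
have [q [q0 q1 [D D0 tD]]] := solve_term_bound (ltr1n R 2).
have tD' m l : (m <= n.+1)%N ->
    normc (solve_term a b r m l) <= D * 2 ^+ n.+1 * q ^+ l.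
  move=> mn; apply: le_trans (tD m l) _; rewrite ler_wpM2r ?exprn_ge0 //.
  by rewrite (ler_wpM2l (ltW D0)) // ler_weXn2l // ler1n.
rewrite /solve (@csum_shift _ _ (solve_term a b r n.+1) (b n / a n) (D * 2 ^+ n.+1) q) //.
- rewrite /solve_term addn0 big_geq // mul1r; field.
  exact: a_neq0.
- by move=> l; apply: tD'.
- move=> l; rewrite /solve_term addnS -addSn.
  by rewrite big_ltn ?addSn ?ltnS ?leq_addr // -mulrA.
Qed.

End Solve.
End ScalarSequences.

(** * Lowest terms for a graded monomial order *)

Section LeadingTerm.
Variables (R : realType) (d : nat) (v : 'I_d -> nat).
Implicit Types (a b m : 'X_{1..d}) (p q : {mpoly R[i][d]}).

Definition weight m : nat := (\sum_i v i * m i)%N.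

(** The graded comparison of monomials refined by the weight. Being compatible with
    the addition of exponents, it yields multiplicative lowest terms. *)
Definition above a m : bool :=
  (mdeg a < mdeg m)%N || (mdeg a == mdeg m) && (weight a < weight m)%N.

Lemma weightD a b : weight (a + b)%MM = (weight a + weight b)%N.
Proof. by rewrite /weight -big_split; apply: eq_bigr => i _; rewrite mnmDE mulnDr. Qed.

Lemma weightU i : weight U_(i)%MM = v i.
Proof.
rewrite /weight (bigD1 i) //= mnm1E eqxx muln1 big1 ?addn0 // => k ki.
by rewrite mnm1E eq_sym (negPf ki) muln0.
Qed.

Lemma above_irr a : above a a = false.
Proof. by rewrite /above !ltnn andbF. Qed.

Lemma aboveD a b m n : (m = a \/ above a m) -> (n = b \/ above b n) ->
  (m = a /\ n = b) \/ above (a + b) (m + n).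
Proof.
rewrite /above !mdegD !weightD => -[->|am] [->|bn]; [by left|right..]; lia.
Qed.

Definition lead_term a (c : R[i]) p : Prop :=
  p@_a = c /\ forall m, p@_m != 0 -> m = a \/ above a m.

Lemma lead_term1 : lead_term 0%MM 1 1.
Proof.
split=> [|m]; rewrite mcoeff1 ?eqxx //.
by case: (m =P 0%MM) => [->|_]; [left|rewrite eqxx].
Qed.

Lemma lead_termM a b c e p q :
  lead_term a c p -> lead_term b e q -> lead_term (a + b) (c * e) (p * q).
Proof.
move=> [pa pab] [qb qab].
have key (m n : 'X_{1..d}) : p@_m * q@_n != 0 ->
    (m = a /\ n = b) \/ above (a + b) (m + n).
  by rewrite mulf_eq0 => /norP[/pab pm /qab qn]; apply: aboveD.
split=> [|m]; rewrite mcoeffM.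
  rewrite (bigD1 (BMultinom (leq_ltn_trans (leq_addr (mdeg b) _)
      (eq_leq (congr1 S (esym (mdegD a b))))),
    BMultinom (leq_ltn_trans (leq_addl (mdeg a) _)
      (eq_leq (congr1 S (esym (mdegD a b))))))) //= pa qb big1 ?addr0 //.
  move=> [m n] /= /andP[/eqP mn neq]; apply: contraNeq neq => /key[[ma nb]|].
    by rewrite xpair_eqE -!val_eqE /= ma nb !eqxx.
  by rewrite -mn above_irr.
move=> s0; have [[m' n] /= /andP[/eqP mE mn0]] : exists k : 'X_{1..d < (mdeg m).+1, (mdeg m).+1},
    (m == (k.1 + k.2)%MM) && (p@_k.1 * q@_k.2 != 0).
  apply/existsP; apply: contraNT s0; rewrite negb_exists => /forallP k0.
  apply/eqP/big1 => k mk; have := k0 k; rewrite mk /= negbK; exact: eqP.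
by rewrite mE; case: (key _ _ mn0) => [[-> ->]|]; [left|right].
Qed.

Lemma lead_termX a c p n : lead_term a c p -> lead_term (a *+ n) (c ^+ n) (p ^+ n).
Proof.
move=> pac; elim: n => [|n IH]; first by rewrite mulm0n !expr0; apply: lead_term1.
by rewrite mulmS !exprS; apply: lead_termM.
Qed.

Lemma lead_term_mon (c : 'I_d -> R[i]) (g : 'I_d -> {mpoly R[i][d]}) a :
  (forall i, lead_term U_(i) (c i) (g i)) ->
  lead_term a (\prod_i c i ^+ a i) (\prod_i g i ^+ a i).
Proof.
move=> gc; rewrite {1}(multinomUE_id a).
elim/big_rec3: _ => [|i p x b _ IH]; first exact: lead_term1.
by apply: lead_termM => //; apply: lead_termX.
Qed.

End LeadingTerm.

(** * Coefficients of a composition *)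

Section Composition.
Variables (R : realType) (d : nat).
Implicit Types (f g h : fseries R d) (a m : 'X_{1..d}) (i j : 'I_d).

Definition powers g N a : {mpoly R[i][d]} := \prod_(i < d) ftrunc N g i ^+ a i.

Lemma fcompE f g j m :
  fcomp f g j m = \sum_(a : 'X_{1..d < (mdeg m).+1}) f j a * (powers g (mdeg m) a)@_m.
Proof.
rewrite /fcomp; set lq := [tuple _ | i < d]; rewrite {1}/ftrunc.
rewrite (big_morph _ (comp_mpolyD lq) (comp_mpoly0 lq)).
rewrite (big_morph _ (mcoeffD m) (mcoeff0 _ m)); apply: eq_bigr => a _ /=.
rewrite comp_mpolyZ mcoeffZ comp_mpolyX; congr (_ * _@__).
by apply: eq_bigr => i _; rewrite tnth_mktuple.
Qed.

(** Lower indices are heavier: a substitution of a lower triangular linear map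
    replaces the variable of index [i] by variables of index at most [i], hence
    can only increase the weight. *)
Definition height (i : 'I_d) : nat := (d - i)%N.

(** The order in which the coefficients of [z^m] in the [j]-th components are
    determined, lexicographic in the degree, the weight and [j]. As the weight is
    at most [d * |m|] and [j] is smaller than [d], the factors [d] and the square
    leave enough room for a single number to encode the triple. *)
Definition rank j m : nat :=
  ((mdeg m ^ 2 * d + weight height m) * d + j)%N.

Lemma weight_le m : (weight height m <= d * mdeg m)%N.
Proof.
rewrite /weight mdegE big_distrr /=; apply: leq_sum => i _.
by rewrite leq_mul2r leq_subr orbT.
Qed.

Lemma rank_above i j a m : above height a m -> (rank i a < rank j m)%N.
Proof.
have := weight_le a; have := ltn_ord i; rewrite /above /rank => id wa am.
have : (mdeg a ^ 2 * d + weight height a < mdeg m ^ 2 * d + weight height m)%N.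
  case/orP: am => [am|/andP[/eqP <-]]; last by rewrite ltn_add2l.
  have : ((mdeg a).+1 ^ 2 * d <= mdeg m ^ 2 * d)%N by rewrite leq_mul2r leq_sqr am orbT.
  nia.
set x := (_ + weight _ a)%N; set y := (_ + weight _ m)%N; nia.
Qed.

Lemma rank_ord i j m : (i < j)%N -> (rank i m < rank j m)%N.
Proof. by rewrite ltn_add2l. Qed.

Lemma lead_term_ftrunc f N i : in_F f -> (0 < N)%N -> is_trig_mx (linpart f) ->
  lead_term height U_(i) (linpart f i i) (ftrunc N f i).
Proof.
move=> f0 N0 /is_trig_mxP ftrig; split=> [|m]; rewrite mcoeff_ftrunc.
  by rewrite mdeg1 N0 mxE.
case: leqP => mN; last by rewrite eqxx.
case: (boolP (mdeg m == 1%N)) => [/mdeg1P[k /eqP ->]|m1 fim].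
  have := ftrig i k; rewrite mxE => ik fik.
  case: (ltngtP i k) => [/ik f_eq0|ki|/val_inj ->]; last by left.
    by rewrite f_eq0 eqxx in fik.
  right; rewrite /above !mdeg1 eqxx !weightU /height /=; move: (ltn_ord i); lia.
right; rewrite /above mdeg1; have : mdeg m != 0%N.
  by apply: contraNneq fim => /eqP; rewrite mdeg_eq0 => /eqP ->; rewrite f0.
by move: m1; case: (mdeg m) => [|[|]].
Qed.

(** The coefficient [f j m] enters the coefficient of [z^m] in the [j]-th
    component of [f o g] through the diagonal of the linear part of [g]; all
    other coefficients of [f] which enter it have smaller rank, because
    [lead_term_mon] makes [z^a] the lowest term of [g ^ a]. *)
Lemma fcomp_sub_outer f f' g j m : in_F g -> is_trig_mx (linpart g) ->
  (0 < mdeg m)%N -> (forall a, (rank j a < rank j m)%N -> f' j a = f j a) ->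
  fcomp f' g j m - fcomp f g j m = \prod_i linpart g i i ^+ m i * (f' j m - f j m).
Proof.
move=> g0 gtrig m0 ff'.
have lead a := lead_term_mon a (fun i => lead_term_ftrunc i g0 m0 gtrig).
rewrite !fcompE -sumrB (bigD1 (BMultinom (ltnSn (mdeg m)))) //= -mulrBl.
rewrite (lead m).1 mulrC [X in _ + X]big1 ?addr0 // => a am.
rewrite -mulrBl; have [->|/(lead a).2[ma|/rank_above/ff' ->]] :=
  eqVneq (powers g (mdeg m) a)@_m 0.
- by rewrite mulr0.
- by case/eqP: am; apply/val_inj.
- by rewrite subrr mul0r.
Qed.

(** A product of at least two series without constant term sees the
    coefficients of the factors only in degrees smaller than that of the
    coefficient which is computed. *)
Lemma powers_local h h' a m : in_F h -> in_F h' -> (1 < mdeg a)%N ->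
  (forall i b, (mdeg b < mdeg m)%N -> h' i b = h i b) ->
  (powers h' (mdeg m) a)@_m = (powers h (mdeg m) a)@_m.
Proof.
move=> h0 h'0 a2 hh'; set k := (mdeg m).-1.
pose close s (p p' : {mpoly R[i][d]}) :=
  [/\ ord_ge s p, ord_ge s p' & ord_ge (s + k) (p - p')].
have close1 : close 0%N 1 1 by split=> // b _; rewrite subrr mcoeff0.
have closeM s t p p' q q' : close s p p' -> close t q q' -> close (s + t)%N (p * q) (p' * q').
  move=> [sp sp' spp'] [tq tq' tqq']; split; [exact: ord_geM|exact: ord_geM|].
  have -> : p * q - p' * q' = (p - p') * q + p' * (q - q') by ring.
  move=> b bk; rewrite mcoeffD (ord_geM spp' tq) ?(ord_geM sp' tqq') ?addr0 //; lia.
have ord1 f N i : in_F f -> ord_ge 1 (ftrunc N f i).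
  by move=> f0 b; rewrite ltnS leqn0 mdeg_eq0 => /eqP->; rewrite mcoeff_ftrunc f0 if_same.
have closeh i : close 1%N (ftrunc (mdeg m) h' i) (ftrunc (mdeg m) h i).
  split; [exact: ord1|exact: ord1|move=> b; rewrite add1n ltnS => bk].
  rewrite mcoeffB !mcoeff_ftrunc; case: leqP => [bm|_]; last by rewrite subrr.
  have [m0|m0] := posnP (mdeg m); last by rewrite hh' ?subrr //; move: bk m0; rewrite /k; lia.
  by move: bm; rewrite m0 leqn0 mdeg_eq0 => /eqP->; rewrite h0 h'0 subrr.
have [_ _ diff] : close (mdeg a) (powers h' (mdeg m) a) (powers h (mdeg m) a).
  rewrite mdegE /powers; elim/big_rec3: _ => [//|i p p' s _ IH].
  apply/closeM => //; elim: (a i) => [|n IHn]; first by rewrite !expr0.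
  by rewrite !exprS -add1n; apply: closeM.
apply/eqP; rewrite -subr_eq0 -mcoeffB; apply/eqP/diff.
by rewrite /k; lia.
Qed.

(** The terms of degree at least 2 of [g] only see coefficients of [h] of smaller
    degree, and the linear part of [g] adds to the [j]-th component of [h]
    multiples of components of smaller index. *)
Lemma fcomp_sub_inner g h h' j m : in_F g -> in_F h -> in_F h' ->
  is_trig_mx (linpart g) -> (1 < mdeg m)%N ->
  (forall i a, (rank i a < rank j m)%N -> h' i a = h i a) ->
  fcomp g h' j m - fcomp g h j m = linpart g j j * (h' j m - h j m).
Proof.
move=> g0 h0 h'0 /is_trig_mxP gtrig m1 hh'.
have powersU f i : (powers f (mdeg m) U_(i)%MM)@_m = f i m.
  rewrite /powers (bigD1 i) //= mnm1E eqxx expr1 big1 ?mulr1 ?mcoeff_ftrunc ?leqnn //.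
  by move=> k ki; rewrite mnm1E eq_sym (negPf ki) expr0.
have m1' : (mdeg U_(j) < (mdeg m).+1)%N by rewrite mdeg1 ltnS ltnW.
rewrite !fcompE -sumrB (bigD1 (BMultinom m1')) //= !powersU -mulrBr mxE.
rewrite [X in _ + X]big1 ?addr0 // => a aj; rewrite -mulrBr.
have [a0|a0] := posnP (mdeg a).
  by move/eqP: a0; rewrite mdeg_eq0 => /eqP ->; rewrite g0 mul0r.
have [a1|a1] := ltnP 1 (mdeg a).
  rewrite (@powers_local h h') ?subrr ?mulr0 // => i b bm.
  by apply/hh'/rank_above; rewrite /above bm.
have /mdeg1P[i /eqP aE] : mdeg a == 1%N by rewrite eqn_leq a1 a0.
rewrite aE !powersU; case: (ltngtP i j) => [ij|ji|/val_inj ij].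
- by rewrite hh' ?subrr ?mulr0 // rank_ord.
- by have := gtrig _ _ ji; rewrite mxE => ->; rewrite mul0r.
- by case/eqP: aj; apply/val_inj; rewrite /= aE ij.
Qed.

Definition residual f g h h1 : fseries R d :=
  fun j m => fcomp h1 f j m - fcomp g h j m.

(** At the coefficient [(j, m)], the defect of conjugacy is affine in the three
    unknowns of that place once all coefficients of smaller rank are fixed. This
    is what decouples the conjugacy equation into scalar equations. The linear part
    of [h'] being the identity, the unknown of [g] enters with factor 1. *)
Lemma residual_sub f g g' h h' h1 h1' j m :
  in_F f -> in_F g -> in_F g' -> in_F h -> in_F h' ->
  is_trig_mx (linpart f) -> is_trig_mx (linpart g) -> linpart h' = 1%:M ->
  (1 < mdeg m)%N ->
  (forall i a, (rank i a < rank j m)%N ->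
    [/\ g' i a = g i a, h' i a = h i a & h1' i a = h1 i a]) ->
  residual f g' h' h1' j m - residual f g h h1 j m =
  \prod_i linpart f i i ^+ m i * (h1' j m - h1 j m)
  - linpart g j j * (h' j m - h j m) - (g' j m - g j m).
Proof.
move=> f0 g0 g'0 h0 h'0 ftrig gtrig h'1 m1 agree.
have m0 := ltnW m1.
have outer_h : fcomp h1' f j m - fcomp h1 f j m =
    \prod_i linpart f i i ^+ m i * (h1' j m - h1 j m).
  by apply: fcomp_sub_outer => // a /agree[].
have inner : fcomp g h' j m - fcomp g h j m = linpart g j j * (h' j m - h j m).
  by apply: fcomp_sub_inner => // i a /agree[].
have outer_g : fcomp g' h' j m - fcomp g h' j m = g' j m - g j m.
  rewrite (@fcomp_sub_outer g g' h' j m) //; last by move=> a /agree[].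
    rewrite h'1 [X in X * _]big1 ?mul1r // => i _.
    by rewrite mxE eqxx expr1n.
  by rewrite h'1 scalar_mx_is_trig.
rewrite -outer_h -inner -outer_g /residual.
move: (fcomp h1' f j m) (fcomp h1 f j m) (fcomp g' h' j m) (fcomp g h' j m)
  (fcomp g h j m) => A B C D E; ring.
Qed.

Lemma ftrunc1_id h i : in_F h -> linpart h = 1%:M -> ftrunc 1 h i = 'X_i.
Proof.
move=> h0 /matrixP h1; apply/mpolyP => m; rewrite mcoeff_ftrunc mcoeffX.
case: leqP => [|m1]; last first.
  by case: eqP => // mi; move: m1; rewrite -mi mdeg1.
rewrite leq_eqVlt => /orP[/mdeg1P[k /eqP ->]|].
  by have := h1 i k; rewrite !mxE eq_mnm1.
rewrite ltnS leqn0 mdeg_eq0 => /eqP ->; rewrite h0.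
by case: eqP => // /(congr1 mdeg); rewrite mdeg1 mdeg0.
Qed.

Lemma residual_linear f g h h1 j m : in_F f -> in_F g -> in_F h ->
  linpart h = 1%:M -> in_F h1 -> linpart h1 = 1%:M -> linpart f = linpart g ->
  (mdeg m <= 1)%N -> residual f g h h1 j m = 0.
Proof.
move=> f0 g0 h0 hI h10 h1I /matrixP fg m1.
rewrite /residual -(fcomp_trunc h1 j f0 m1 m1) -(fcomp_trunc g j h0 m1 m1).
rewrite ftrunc1_id // comp_mpolyXU -tnth_nth tnth_mktuple.
have -> : [tuple ftrunc 1 h i | i < d] = [tuple 'X_i | i < d].
  by apply/eq_from_tnth => i; rewrite !tnth_mktuple ftrunc1_id.
rewrite comp_mpoly_id !mcoeff_ftrunc m1; move: m1.
rewrite leq_eqVlt => /orP[/mdeg1P[k /eqP ->]|].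
  by have := fg j k; rewrite !mxE => ->; rewrite subrr.
by rewrite ltnS leqn0 mdeg_eq0 => /eqP ->; rewrite f0 g0 subrr.
Qed.

End Composition.

(** * Norms of homogeneous parts and coefficients *)

Section CoefficientBounds.
Variables (R : realType) (d : nat).
Implicit Types (f g h : fseries R d) (a b m : 'X_{1..d}) (i j : 'I_d).

Lemma subexp_mcoeffM (p q : nat -> {mpoly R[i][d]}) :
  (forall m, subexp (fun n => (p n)@_m)) -> (forall m, subexp (fun n => (q n)@_m)) ->
  forall m, subexp (fun n => (p n * q n)@_m).
Proof.
move=> sp sq m; under [X in subexp X]eq_fun => n do rewrite mcoeffM.
by apply: subexp_sum => k; apply: subexpM.
Qed.

Lemma subexp_powers (F : nat -> fseries R d) N a :
  (forall j m, subexp (fun n => F n j m)) ->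
  forall m, subexp (fun n => (powers (F n) N a)@_m).
Proof.
move=> sF; rewrite /powers.
have s1 m : subexp (fun n : nat => (1 : {mpoly R[i][d]})@_m) by apply: subexp_cst.
elim: (index_enum _) => [|i r IH] m.
  under [X in subexp X]eq_fun => n do rewrite big_nil.
  exact: s1.
under [X in subexp X]eq_fun => n do rewrite big_cons.
apply: subexp_mcoeffM => //; elim: (a i) => [|k IHk] b.
  under [X in subexp X]eq_fun => n do rewrite expr0.
  exact: s1.
under [X in subexp X]eq_fun => n do rewrite exprS.
apply: subexp_mcoeffM => // {}b; under [X in subexp X]eq_fun => n do rewrite mcoeff_ftrunc.
by case: (mdeg b <= N)%N; [apply: sF|apply: subexp_cst].
Qed.

Lemma subexp_fcomp (F G : nat -> fseries R d) j m :
  (forall j m, subexp (fun n => F n j m)) ->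
  (forall j m, subexp (fun n => G n j m)) ->
  subexp (fun n => fcomp (F n) (G n) j m).
Proof.
move=> sF sG; under [X in subexp X]eq_fun => n do rewrite fcompE.
by apply: subexp_sum => a; apply: subexpM => //; apply: subexp_powers.
Qed.

Lemma peval_hpart k f z j :
  peval (hpart k f) z j 0 =
  \sum_(m : 'X_{1..d < k.+1} | mdeg m == k) f j m * \prod_i z i 0 ^+ m i.
Proof.
rewrite mxE /hpart raddf_sum /=; apply: eq_bigr => m _.
by rewrite mevalZ mevalX.
Qed.

Lemma normc_prod (I : Type) (r : seq I) (P : pred I) (F : I -> R[i]) :
  normc (\prod_(i <- r | P i) F i) = \prod_(i <- r | P i) normc (F i).
Proof. by apply: big_morph; [exact: normcM|exact: normc1]. Qed.

Lemma normcX (z : R[i]) n : normc (z ^+ n) = normc z ^+ n.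
Proof. by elim: n => [|n IH]; rewrite ?expr0 ?normc1 // !exprS normcM IH. Qed.

Lemma pnorm_hpart_le k f :
  pnorm (hpart k f) <= \sum_j \sum_(m : 'X_{1..d < k.+1}) normc (f j m).
Proof.
have s0 j : 0 <= \sum_(m : 'X_{1..d < k.+1}) normc (f j m).
  by apply: sumr_ge0 => m _; apply: normc_ge0.
apply: ge_sup; first exact: (pnorm_has_sup _).1.
move=> _ [z /= z1 <-]; apply: ler_vnorm => [|j]; first exact: sumr_ge0.
rewrite (bigD1 j) //= -[leLHS]addr0; apply: lerD; last exact: sumr_ge0.
rewrite peval_hpart; apply: le_trans (ler_normc_sum _ _ _) _.
rewrite [leRHS](bigID (fun m : 'X_{1..d < k.+1} => mdeg m == k)) /=.
rewrite -[leLHS]addr0; apply: lerD; last by apply: sumr_ge0 => m _; apply: normc_ge0.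
apply: ler_sum => m _; rewrite normcM ler_piMr ?normc_ge0 // normc_prod.
apply: prodr_ile1 => i _; rewrite normcX exprn_ge0 ?normc_ge0 //=.
by rewrite exprn_ile1 ?normc_ge0 // (le_trans (normc_le_vnorm _ _)).
Qed.

Lemma subexp_subexponential (F : nat -> fseries R d) :
  (forall j m, subexp (fun n => F n j m)) -> subexponential F.
Proof.
move=> sF k _ theta t1.
have [A A0 FA] : exists2 A : R, 0 < A &
    forall n, \sum_j \sum_(m : 'X_{1..d < k.+1}) normc (F n j m) <= A * theta ^+ n.
  have /choice[A AP] : forall jm : 'I_d * 'X_{1..d < k.+1}, exists A : R,
      0 < A /\ forall n, normc (F n jm.1 jm.2) <= A * theta ^+ n.
    by move=> jm; have [A A0 FA] := sF jm.1 jm.2 _ t1; exists A.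
  exists (1 + \sum_jm A jm) => [|n].
    by rewrite ltr_wpDr // sumr_ge0 // => jm _; apply/ltW; case: (AP jm).
  rewrite pair_big /= mulrDl mulr_suml; apply: ler_wpDl.
    by rewrite mul1r exprn_ge0 // (le_trans ler01) // ltW.
  by apply: ler_sum => jm _; case: (AP jm) => _; apply.
by exists A => // n; apply: le_trans (pnorm_hpart_le _ _) (FA n).
Qed.

Section Interpolation.
Variable k : nat.

Definition node (s : 'I_k.+1) : R[i] := s%:R / k.+1%:R.

Lemma node_le1 s : normc (node s) <= 1.
Proof.
have nat_norm n : normc (n%:R : R[i]) = n%:R.
  by rewrite normcMn normc1.
rewrite normcM normcV !nat_norm ler_pdivrMr ?ltr0n // mul1r ler_nat.
exact: ltnW.
Qed.

Lemma node_inj : injective node.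
Proof.
move=> s t /(mulIf _) st; apply/val_inj/eqP; rewrite -(eqr_nat R[i]).
by apply/eqP/st; rewrite invr_eq0 pnatr_eq0.
Qed.

Definition vandermonde : 'M[R[i]]_k.+1 := Vandermonde k.+1 (\row_s node s).

Lemma vandermonde_unit : vandermonde \in unitmx.
Proof.
rewrite unitmxE unitfE det_Vandermonde; apply/prodf_neq0 => i _.
apply/prodf_neq0 => j ij; rewrite !mxE subr_eq0; apply: contraTneq ij.
by move=> /node_inj ->; rewrite ltnn.
Qed.

Definition dual_weight m (s : {ffun 'I_d -> 'I_k.+1}) : R[i] :=
  \prod_i invmx vandermonde (s i) (inord (m i)).

(** The monomials of degree at most [k] in each variable are linearly
    independent on the grid of nodes: the tensor power of the inverse of the
    Vandermonde matrix extracts a single coefficient. *)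
Lemma dual_weightP m b : mdeg m = k -> mdeg b = k ->
  \sum_s dual_weight m s * \prod_i node (s i) ^+ b i = (b == m)%:R.
Proof.
move=> mk bk.
have le_deg (a : 'X_{1..d}) i : mdeg a = k -> (a i < k.+1)%N.
  by move=> <-; rewrite ltnS mdegE (bigD1 i) //= leq_addr.
under eq_bigr => s _ do rewrite -big_split /=.
rewrite -(bigA_distr_bigA (fun i t =>
  invmx vandermonde t (inord (m i)) * node t ^+ b i)) /=.
have E i : \sum_t invmx vandermonde t (inord (m i)) * node t ^+ b i = (b i == m i)%:R.
  have /matrixP/(_ (inord (b i)) (inord (m i))) := mulmxV vandermonde_unit.
  rewrite !mxE -val_eqE /= !inordK ?le_deg // => <-.
  by apply: eq_bigr => t _; rewrite !mxE inordK ?le_deg // mulrC.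
under eq_bigr => i _ do rewrite E.
have [->|bm] := eqVneq b m; first by rewrite big1 // => i _; rewrite eqxx.
have /existsP[i bmi] : [exists i, b i != m i].
  apply: contraNT bm; rewrite negb_exists => /forallP bm.
  by apply/eqP/mnmP => i; apply/eqP; rewrite -[_ == _]negbK.
by rewrite (bigD1 i) //= (negPf bmi) mul0r.
Qed.

(** A substitute for the Cauchy estimates: by [dual_weightP] the coefficient is a
    combination of values on the grid, which lies in the unit polydisc. *)
Lemma mcoeff_le_pnorm m f j : mdeg m = k ->
  normc (f j m) <= (\sum_s normc (dual_weight m s)) * pnorm (hpart k f).
Proof.
move=> mk.
pose z (s : {ffun 'I_d -> 'I_k.+1}) : 'cV[R[i]]_d := \col_i node (s i).
have -> : f j m = \sum_s dual_weight m s * peval (hpart k f) (z s) j 0.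
  under eq_bigr => s _ do rewrite peval_hpart mulr_sumr.
  rewrite exchange_big /=.
  have mk' : (mdeg m < k.+1)%N by rewrite mk.
  rewrite (bigD1 (BMultinom mk')) /= ?mk // [X in _ = _ + X]big1 ?addr0; last first.
    move=> b /andP[/eqP bk]; rewrite bmeqP /= => /negPf bm; rewrite (eq_bigr (fun s =>
      f j b * (dual_weight m s * \prod_i node (s i) ^+ b i))) => [|s _].
      by rewrite -mulr_sumr dual_weightP // bm mulr0.
    by rewrite mulrCA; under eq_bigr => i _ do rewrite mxE.
  rewrite (eq_bigr (fun s =>
      f j m * (dual_weight m s * \prod_i node (s i) ^+ m i))) => [|s _].
    by rewrite -mulr_sumr dual_weightP // eqxx mulr1.
  by rewrite mulrCA; under eq_bigr => i _ do rewrite mxE.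
apply: le_trans (ler_normc_sum _ _ _) _; rewrite mulr_suml; apply: ler_sum => s _.
rewrite normcM ler_wpM2l ?normc_ge0 //; apply: le_trans (normc_le_vnorm _ _) _.
apply: sup_upper_bound; first exact: pnorm_has_sup.
exists (z s) => //=; apply: ler_vnorm => // i; rewrite mxE; exact: node_le1.
Qed.

End Interpolation.

Lemma subexponential_subexp (F : nat -> fseries R d) :
  (forall n, in_F (F n)) -> subexponential F ->
  forall j m, subexp (fun n => F n j m).
Proof.
move=> F0 sF j m theta t1.
have [m0|m0] := posnP (mdeg m).
  exists 1 => // n; move/eqP: m0; rewrite mdeg_eq0 => /eqP ->.
  by rewrite F0 normc0 mul1r exprn_ge0 // (le_trans ler01) // ltW.
have [A A0 FA] := sF _ m0 _ t1.
set K := \sum_s normc (dual_weight (k := mdeg m) m s).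
have K0 : 0 <= K by apply: sumr_ge0 => s _; apply: normc_ge0.
exists ((K + 1) * A) => [|n]; first by rewrite mulr_gt0 // ltr_wpDl.
apply: le_trans (mcoeff_le_pnorm _ _ erefl) _; rewrite -/K -mulrA.
have p0 : 0 <= A * theta ^+ n.
  by rewrite mulr_ge0 ?exprn_ge0 ?(ltW A0) // ltW // (lt_trans ltr01).
apply: le_trans (ler_wpM2l K0 (FA n)) _.
by rewrite ler_wpM2r // lerDl.
Qed.

End CoefficientBounds.

(** * Diagonal entries of products of triangular matrices *)

Section Diagonals.
Variables (R : realType) (d : nat).
Implicit Types (A : 'M[R[i]]_d) (L : nat -> 'M[R[i]]_d) (i j : 'I_d).

Lemma diag_le_opnorm A j : normc (A j j) <= opnorm A.
Proof.
pose f : fseries R d := fun k m => \sum_i A k i * (m == U_(i)%MM)%:R.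
have fA : linpart f = A.
  apply/matrixP => k i; rewrite mxE /f (bigD1 i) //= eqxx mulr1 big1 ?addr0 // => l li.
  by rewrite eq_mnm1 eq_sym (negPf li) mulr0.
have supA : has_sup [set vnorm (A *m z) | z in [set z | vnorm z <= 1]]%classic.
  suff -> : [set vnorm (A *m z) | z in [set z | vnorm z <= 1]]%classic =
      [set vnorm (peval (hpart 1 f) z) | z in [set z | vnorm z <= 1]]%classic.
    exact: pnorm_has_sup.
  by apply/seteqP; split=> _ [z z1 <-]; exists z; rewrite // peval_hpart1 fA.
pose e : 'cV[R[i]]_d := delta_mx j 0.
have <- : (A *m e) j 0 = A j j.
  rewrite mxE (bigD1 j) //= !mxE !eqxx mulr1 big1 ?addr0 // => l /negPf lj.
  by rewrite mxE lj mulr0.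
apply: le_trans (normc_le_vnorm _ _) _; apply: sup_upper_bound supA _ _.
exists e => //=; apply: ler_vnorm => // l; rewrite mxE.
by case: (_ && _); rewrite ?normc1 ?normc0.
Qed.

Lemma trig_prod (s : seq nat) L : (forall n, is_trig_mx (L n)) ->
  is_trig_mx (\prod_(k <- s) L k) /\
  forall j, (\prod_(k <- s) L k) j j = \prod_(k <- s) L k j j.
Proof.
move=> Ltrig; elim: s => [|k s [trig_s diag_s]].
  rewrite big_nil; split; first exact: scalar_mx_is_trig.
  by move=> j; rewrite big_nil mxE eqxx.
rewrite big_cons; set P := \prod_(_ <- s) _ in trig_s diag_s *.
have kE i j : (L k * P) i j = \sum_l L k i l * P l j by rewrite mxE.
split=> [|j].
  apply/is_trig_mxP => i j ij; rewrite kE big1 // => l _.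
  have [il|li] := ltnP i l; first by rewrite (is_trig_mxP (Ltrig k)) ?mul0r.
  by rewrite (is_trig_mxP trig_s) ?mulr0 // (leq_ltn_trans li).
rewrite kE big_cons -diag_s (bigD1 j) //= big1 ?addr0 // => l lj.
case: (ltngtP j l) => [jl|l_lt_j|/val_inj jl]; last by rewrite jl eqxx in lj.
  by rewrite (is_trig_mxP (Ltrig k)) ?mul0r.
by rewrite (is_trig_mxP trig_s) ?mulr0.
Qed.

Lemma mprod_diag L n m j : (forall n, is_trig_mx (L n)) ->
  mprod L n m j j = dprod L n m j.
Proof.
by move=> Ltrig; rewrite (trig_prod _ Ltrig).2 /dprod (perm_big _ (permEl (perm_rev _))).
Qed.

Lemma mprod_unit L n m : (forall n, L n \in unitmx) -> mprod L n m \in unitmx.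
Proof.
move=> Lunit; rewrite /mprod; elim: (rev _) => [|k s IH].
  by rewrite big_nil; apply: unitmx1.
by rewrite big_cons; rewrite (_ : _ * _ = L k *m \prod_(j <- s) L j) // unitmx_mul Lunit.
Qed.

Lemma trig_unit_diag A j : is_trig_mx A -> A \in unitmx -> A j j != 0.
Proof.
move=> Atrig; rewrite unitmxE unitfE det_trig // => /prodf_neq0; exact.
Qed.

Lemma invmx_trig_diag A j : is_trig_mx A -> A \in unitmx ->
  invmx A j j = (A j j)^-1.
Proof.
move=> Atrig Aunit; pose B := invmx A.
have AB i k : \sum_l A i l * B l k = (i == k)%:R.
  by have /matrixP/(_ i k) := mulmxV Aunit; rewrite !mxE => <-.
have Btrig n : forall i k : 'I_d, i = n :> nat -> (i < k)%N -> B i k = 0.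
  elim/ltn_ind: n => n IH i k i_n ik; have Aii := trig_unit_diag i Atrig Aunit.
  have := AB i k; rewrite -val_eqE (ltn_eqF ik) (bigD1 i) //= big1 ?addr0.
    by move/eqP; rewrite mulf_eq0 (negPf Aii) => /eqP.
  move=> l li; case: (ltngtP i l) => [il|l_lt_i|/val_inj il]; last by rewrite il eqxx in li.
    by rewrite (is_trig_mxP Atrig) ?mul0r.
  by rewrite (IH l) ?mulr0 -?i_n // (ltn_trans l_lt_i).
have Ajj := trig_unit_diag j Atrig Aunit.
have := AB j j; rewrite eqxx (bigD1 j) //= big1 ?addr0 => [|l lj].
  by move=> /(congr1 (fun x => (A j j)^-1 * x)); rewrite mulKf // mulr1.
case: (ltngtP j l) => [jl|l_lt_j|/val_inj jl]; last by rewrite jl eqxx in lj.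
  by rewrite (is_trig_mxP Atrig) ?mul0r.
by rewrite (Btrig l) ?mulr0.
Qed.

End Diagonals.

(** * Bounds for the multipliers of the scalar equations *)

Section SmallDivisors.
Variables (R : realType) (d : nat) (L : nat -> 'M[R[i]]_d) (c lambda mu : R).
Implicit Types (i j : 'I_d) (m : 'X_{1..d}).
Hypothesis L_unit : forall n, L n \in unitmx.
Hypothesis L_trig : forall n, is_trig_mx (L n).
Hypothesis c_gt0 : 0 < c.
Hypothesis lambda_gt0 : 0 < lambda.
Hypothesis lambda_lt1 : lambda < 1.
Hypothesis mu_gt0 : 0 < mu.
Hypothesis L_le : forall n k, (k <= n)%N ->
  opnorm (mprod L n k) <= c * lambda ^+ (n - k).
Hypothesis Linv_le : forall n k, (k <= n)%N ->
  opnorm (invmx (mprod L n k)) <= c * mu ^+ (n - k).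

Lemma dprod_le n l j : normc (dprod L (n + l) n j) <= c * lambda ^+ l.
Proof.
rewrite -mprod_diag //; apply: le_trans (diag_le_opnorm _ _) _.
by have := L_le (leq_addr l n); rewrite addKn.
Qed.

Lemma dprod_inv_le n l j : (normc (dprod L (n + l) n j))^-1 <= c * mu ^+ l.
Proof.
rewrite -normcV -mprod_diag // -invmx_trig_diag; last exact: mprod_unit.
  apply: le_trans (diag_le_opnorm _ _) _.
  by have := Linv_le (leq_addr l n); rewrite addKn.
by case: (trig_prod (rev (index_iota n (n + l))) L_trig).
Qed.

(** The multiplier of the scalar equation: solving for the coefficient of [z^m] at
    time [n] multiplies the one at time [n + 1] by this factor. *)
Definition quotient m j (n : nat) : R[i] := (\prod_i L n i i ^+ m i) / L n j j.

Lemma normc_quotient m j n l :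
  normc (\prod_(n <= k < n + l) quotient m j k) =
  (\prod_i normc (dprod L (n + l) n i) ^+ m i) / normc (dprod L (n + l) n j).
Proof.
rewrite prodf_div normcM normcV exchange_big /= normc_prod; congr (_ / _).
by apply: eq_bigr => i _; rewrite prodrXl normcX.
Qed.

Lemma prodX_le (D : 'I_d -> R) (B : R) m : (forall i, 0 <= D i <= B) ->
  \prod_i D i ^+ m i <= B ^+ mdeg m.
Proof.
move=> DB; rewrite mdegE -prodrXr; apply: ler_prod => i _.
case/andP: (DB i) => D0 DBi; rewrite exprn_ge0 //= lerXn2r ?nnegrE //.
exact: le_trans DBi.
Qed.

(** Geometric decay in the number of steps, up to a subexponential factor in the
    initial time: the summability condition of the forward series. *)
Definition dominated (u : nat -> R[i]) (rho : R) : Prop :=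
  forall theta, 1 < theta -> exists2 C : R, 0 < C &
  forall n l, normc (\prod_(n <= k < n + l) u k) <= C * theta ^+ n * rho ^+ l.

(** In high degree the contraction of [|m|] factors beats the single division by
    [lambda(j)], whose cost is at most [c * mu ^+ l]. *)
Lemma quotient_dominated_deg (m0 : nat) m j : (m0 < mdeg m)%N ->
  dominated (quotient m j) (lambda ^+ m0.+1 * mu).
Proof.
move=> m0m theta t1; exists (c ^+ mdeg m * c) => [|n l].
  by rewrite mulr_gt0 ?exprn_gt0.
rewrite normc_quotient.
apply: le_trans (_ : (c * lambda ^+ l) ^+ mdeg m * (c * mu ^+ l) <= _).
  apply: ler_pM; rewrite ?invr_ge0 ?normc_ge0 //; last exact: dprod_inv_le.
    by apply: prodr_ge0 => i _; rewrite exprn_ge0 ?normc_ge0.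
  by apply: prodX_le => i; rewrite normc_ge0 dprod_le.
rewrite exprMn mulrACA; apply: ler_pM.
- by rewrite !mulr_ge0 ?exprn_ge0 // ltW.
- by rewrite mulr_ge0 ?exprn_ge0 // ltW.
- rewrite ler_peMr ?subexp_ge1 // mulr_ge0 ?exprn_ge0 //; exact: ltW.
rewrite [leRHS]exprMn ler_wpM2r ?exprn_ge0 //; first exact: ltW.
rewrite -!exprM; apply: ler_wiXn2l; rewrite ?ltW //.
by rewrite mulnC leq_mul2l m0m orbT.
Qed.

Hypothesis diag_le : forall theta : R, 1 < theta -> exists2 C : R, 0 < C & forall n l : nat,
  (\big[Num.max/0]_(h < d) normc (dprod L (n + l) n h)) *
  (\big[Num.max/0]_(i < d) \big[Num.max/0]_(j < d | (i <= j)%N)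
     (normc (dprod L (n + l) n j) / normc (dprod L (n + l) n i)))
    <= C * theta ^+ n * lambda ^+ l.

(** A monomial which is not of triangular form contains, besides a variable [z_i]
    with [j <= i], at least one more variable [z_h]; the factor
    [lambda(h) lambda(i) / lambda(j)] is controlled by the assumption on the
    diagonal entries, and the other ones are bounded. *)
Lemma quotient_dominated_var m i j : (1 < mdeg m)%N -> (j <= i)%N -> (0 < m i)%N ->
  dominated (quotient m j) lambda.
Proof.
move=> m1 ji mi theta t1; have [C C0 CP] := diag_le t1.
have leU (b : 'X_{1..d}) k : (0 < b k)%N -> (U_(k) <= b)%MM.
  by move=> bk; apply/mnm_lepP => s; rewrite mnm1E; case: eqP => // <-.
set m' := (m - U_(i))%MM.
have mE : m = (U_(i) + m')%MM by rewrite addmC submK ?leU.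
have deg_m' : mdeg m = (mdeg m').+1 by rewrite mE mdegD mdeg1.
have [h m'h] : exists h, (0 < m' h)%N.
  have : mdeg m' != 0%N by rewrite -lt0n -ltnS -deg_m'.
  by rewrite mdegE sum_nat_eq0 negb_forall => /existsP[h /= m'h]; exists h; rewrite lt0n.
set m'' := (m' - U_(h))%MM.
have m'E : m' = (U_(h) + m'')%MM by rewrite addmC submK ?leU.
exists (C * c ^+ mdeg m'') => [|n l]; first by rewrite mulr_gt0 ?exprn_gt0.
rewrite normc_quotient; pose D k := normc (dprod L (n + l) n k).
have D0 k : 0 <= D k := normc_ge0 _.
have prodD (a b : 'X_{1..d}) : \prod_k D k ^+ (a + b)%MM k = (\prod_k D k ^+ a k) * \prod_k D k ^+ b k.
  by rewrite -big_split; apply: eq_bigr => k _; rewrite mnmDE exprD.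
have prodU k : \prod_s D s ^+ U_(k)%MM s = D k.
  rewrite (bigD1 k) //= mnm1E eqxx expr1 big1 ?mulr1 // => s sk.
  by rewrite mnm1E eq_sym (negPf sk) expr0.
rewrite -[X in X / _]/(\prod_k D k ^+ m k) -[X in _ / X]/(D j) mE prodD prodU m'E prodD prodU.
have -> : D i * (D h * \prod_k D k ^+ m'' k) / D j =
    D h * (D i / D j) * \prod_k D k ^+ m'' k by ring.
have -> : C * c ^+ mdeg m'' * theta ^+ n * lambda ^+ l =
    C * theta ^+ n * lambda ^+ l * c ^+ mdeg m'' by ring.
apply: ler_pM.
- by rewrite !mulr_ge0 ?invr_ge0.
- by apply: prodr_ge0 => k _; rewrite exprn_ge0.
- apply: le_trans (CP n l); apply: ler_pM; rewrite ?mulr_ge0 ?invr_ge0 //.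
    exact: (le_bigmax _ (fun k => D k)).
  apply: le_trans (le_bigmax _ _ j).
  exact: (@le_bigmax_cond _ _ _ _ i (fun k : 'I_d => (j <= k)%N) (fun k => D k / D j)).
apply: prodX_le => k; rewrite D0 /=; apply: le_trans (dprod_le _ _ _) _.
by rewrite ler_piMr ?exprn_ile1 // ltW.
Qed.

End SmallDivisors.

(** * Construction of the conjugacy and of the normal form *)

Section Construction.
Variables (R : realType) (d m0 : nat) (f : nat -> fseries R d) (K : R).
Implicit Types (g h : nat -> fseries R d) (i j : 'I_d) (m : 'X_{1..d}).
Let L n : 'M[R[i]]_d := linpart (f n).

Definition triangular_monomial j m : bool :=
  (mdeg m <= m0)%N && [forall i : 'I_d, (j <= i)%N ==> (m i == 0%N)].

Hypothesis f_in_F : forall n, in_F (f n).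
Hypothesis f_subexp : forall j m, subexp (fun n => f n j m).
Hypothesis L_trig : forall n, is_trig_mx (L n).
Hypothesis L_diag : forall n j, L n j j != 0.
Hypothesis K_gt0 : 0 < K.
Hypothesis L_diag_inv : forall n j, normc (L n j j)^-1 <= K.
Hypothesis nonresonant : forall m j, (1 < mdeg m)%N -> ~~ triangular_monomial j m ->
  exists rho : R, [/\ 0 <= rho, rho < 1 & dominated (quotient L m j) rho].

Definition err g h j m n : R[i] := residual (f n) (g n) (h n) (h n.+1) j m.

(** The corrections to [g] and [h] which cancel the error at [(j, m)]. The error at a
    triangular monomial is moved into [g]; elsewhere it is removed by [h], whose
    coefficients at times [n] and [n + 1] are coupled, so that a whole sequence is
    solved for at once. *)
Definition fix_g g h n : fseries R d := fun j m =>
  if (1 < mdeg m)%N && triangular_monomial j m then err g h j m n else 0.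

Definition fix_h g h n : fseries R d := fun j m =>
  if (1 < mdeg m)%N && ~~ triangular_monomial j m then
    solve (fun k => L k j j) (fun k => \prod_i L k i i ^+ m i) (err g h j m) n
  else 0.

Definition update N (u du : nat -> fseries R d) n : fseries R d := fun j m =>
  if rank j m == N then u n j m + du n j m else u n j m.

(** The first [N] ranks of the solution. Several coefficients may share a rank: they
    do not influence each other's errors, and are corrected simultaneously. *)
Fixpoint approx N : (nat -> fseries R d) * (nat -> fseries R d) :=
  if N is N'.+1 then
    let: (g, h) := approx N' in
    (update N' g (fix_g g h), update N' h (fix_h g h))
  else (fun n j m => if (mdeg m <= 1)%N then f n j m else 0,
        fun n j m => (m == U_(j)%MM)%:R).

Definition approx_g N := (approx N).1.
Definition approx_h N := (approx N).2.

Lemma approx_gS N :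
  approx_g N.+1 = update N (approx_g N) (fix_g (approx_g N) (approx_h N)).
Proof. by rewrite /approx_g /approx_h /=; case: (approx N). Qed.

Lemma approx_hS N :
  approx_h N.+1 = update N (approx_h N) (fix_h (approx_g N) (approx_h N)).
Proof. by rewrite /approx_g /approx_h /=; case: (approx N). Qed.

(** Coefficients are never changed after the step of their rank, so the limit is
    read off along the diagonal. *)
Definition normal_g n : fseries R d := fun j m => approx_g (rank j m).+1 n j m.
Definition normal_h n : fseries R d := fun j m => approx_h (rank j m).+1 n j m.

Lemma approx_stable N n j m : (rank j m < N)%N ->
  approx_g N n j m = normal_g n j m /\ approx_h N n j m = normal_h n j m.
Proof.
elim: N => // N IH; rewrite ltnS leq_eqVlt => /orP[/eqP <-//|rN].
rewrite approx_gS approx_hS /update (ltn_eqF rN); exact: IH.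
Qed.

Lemma approx_linear N n j m : (mdeg m <= 1)%N ->
  approx_g N n j m = f n j m /\ approx_h N n j m = (m == U_(j)%MM)%:R.
Proof.
move=> m1; elim: N => [|N [IHg IHh]]; first by rewrite /approx_g /= m1.
rewrite approx_gS approx_hS /update /fix_g /fix_h ltnNge m1 /= !addr0 !if_same.
by [].
Qed.

Lemma approx_support N n j m : (1 < mdeg m)%N -> ~~ triangular_monomial j m ->
  approx_g N n j m = 0.
Proof.
move=> m1 nres; elim: N => [|N IH]; first by rewrite /approx_g /= leqNgt m1.
by rewrite approx_gS /update /fix_g m1 (negPf nres) /= addr0 if_same.
Qed.

Lemma subexp_err g h j m :
  (forall j m, subexp (fun n => g n j m)) -> (forall j m, subexp (fun n => h n j m)) ->
  subexp (err g h j m).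
Proof.
move=> sg sh; apply: subexpD; first apply: (@subexp_fcomp _ _ (fun n => h n.+1)) => //.
  by move=> i a; apply: (subexp_shift (u := fun n => h n i a)).
by apply: subexpN; apply: subexp_fcomp.
Qed.

Lemma subexp_update N (u du : nat -> fseries R d) j m :
  subexp (fun n => u n j m) -> subexp (fun n => du n j m) ->
  subexp (fun n => update N u du n j m).
Proof. by rewrite /update; case: (rank j m == N) => su sdu //; apply: subexpD. Qed.

Lemma approx_subexp N : (forall j m, subexp (fun n => approx_g N n j m)) /\
  (forall j m, subexp (fun n => approx_h N n j m)).
Proof.
elim: N => [|N [sg sh]].
  split=> j m; rewrite /approx_g /approx_h /=; last exact: subexp_cst.
  by case: (mdeg m <= 1)%N; [apply: f_subexp|apply: subexp_cst].
have serr j m := @subexp_err _ _ j m sg sh.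
split=> j m; rewrite ?approx_gS ?approx_hS; apply: subexp_update => //.
  by rewrite /fix_g; case: (_ && _); [apply: serr|apply: subexp_cst].
rewrite /fix_h; case: (boolP (_ && _)) => [/andP[m1 nres]|_]; last exact: subexp_cst.
have [rho [rho0 rho1 rhoP]] := nonresonant m1 nres.
by apply: (@solve_subexp _ _ _ _ K rho).
Qed.

Lemma normal_subexp : (forall j m, subexp (fun n => normal_g n j m)) /\
  (forall j m, subexp (fun n => normal_h n j m)).
Proof.
split=> j m; first exact: (approx_subexp (rank j m).+1).1.
exact: (approx_subexp (rank j m).+1).2.
Qed.

Lemma normal_linear n j m : (mdeg m <= 1)%N ->
  normal_g n j m = f n j m /\ normal_h n j m = (m == U_(j)%MM)%:R.
Proof. by move=> m1; split; case: (approx_linear (rank j m).+1 n j m1). Qed.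

Lemma normal_support n j m : (1 < mdeg m)%N -> ~~ triangular_monomial j m ->
  normal_g n j m = 0.
Proof. exact: approx_support. Qed.

Lemma in_F_linear (u : fseries R d) n :
  (forall j m, (mdeg m <= 1)%N -> u j m = f n j m) -> in_F u /\ linpart u = L n.
Proof.
move=> uf; split=> [j|]; first by rewrite uf ?mdeg0 // f_in_F.
by apply/matrixP => i j; rewrite !mxE uf // mdeg1.
Qed.

Lemma in_F_identity (u : fseries R d) :
  (forall j m, (mdeg m <= 1)%N -> u j m = (m == U_(j)%MM)%:R) ->
  in_F u /\ linpart u = 1%:M.
Proof.
move=> uI; split=> [j|].
  rewrite uI ?mdeg0 //; case: eqP => // /(congr1 mdeg).
  by rewrite mdeg0 mdeg1.
by apply/matrixP => i j; rewrite !mxE uI ?mdeg1 // eq_mnm1 eq_sym.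
Qed.

Lemma approx_g_in N n : in_F (approx_g N n) /\ linpart (approx_g N n) = L n.
Proof. by apply: in_F_linear => j m /(approx_linear N n j)[]. Qed.

Lemma approx_h_in N n : in_F (approx_h N n) /\ linpart (approx_h N n) = 1%:M.
Proof. by apply: in_F_identity => j m /(approx_linear N n j)[]. Qed.

Lemma normal_g_in n : in_F (normal_g n) /\ linpart (normal_g n) = L n.
Proof. by apply: in_F_linear => j m /(normal_linear n j)[]. Qed.

Lemma normal_h_in n : in_F (normal_h n) /\ linpart (normal_h n) = 1%:M.
Proof. by apply: in_F_identity => j m /(normal_linear n j)[]. Qed.

(** The limit is compared with the approximation just before the rank of [(j, m)]:
    they differ at [(j, m)] by the corrections, which solve the scalar equation. *)
Lemma normal_residual n j m :
  residual (f n) (normal_g n) (normal_h n) (normal_h n.+1) j m = 0.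
Proof.
have [g0 gL] := normal_g_in n; have [h0 hI] := normal_h_in n.
have [h10 h1I] := normal_h_in n.+1.
have [m1|m1] := leqP (mdeg m) 1; first by apply: residual_linear.
set N := rank j m.
have [ag0 agL] := approx_g_in N n; have [ah0 ahI] := approx_h_in N n.
have [ah10 ah1I] := approx_h_in N n.+1.
have stepE : residual (f n) (normal_g n) (normal_h n) (normal_h n.+1) j m
    - err (approx_g N) (approx_h N) j m n =
    \prod_i L n i i ^+ m i * fix_h (approx_g N) (approx_h N) n.+1 j m
    - L n j j * fix_h (approx_g N) (approx_h N) n j m
    - fix_g (approx_g N) (approx_h N) n j m.
  have trig_g : is_trig_mx (linpart (approx_g N n)) by rewrite agL.
  have trig_f : is_trig_mx (linpart (f n)) := L_trig n.
  rewrite /err residual_sub //; last first.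
    by move=> i a /approx_stable st; have [-> ->] := st n; have [_ ->] := st n.+1.
  rewrite agL -/(L n) /normal_g /normal_h approx_gS approx_hS /update eqxx.
  move: (fix_h _ _ n.+1 j m) (fix_h _ _ n j m) (fix_g _ _ n j m) => x1 x y.
  move: (approx_h N n.+1 j m) (approx_h N n j m) (approx_g N n j m) => u1 u v.
  by move: (\prod_i _) (L n j j) => b a; ring.
have [sg sh] := approx_subexp N.
have e_subexp := subexp_err j m sg sh.
move: stepE; rewrite /fix_g /fix_h m1 /=.
move: (residual _ _ _ _ _ _) (err _ _ _ _) e_subexp => r e e_subexp.
have [tri|ntri] /= := boolP (triangular_monomial j m).
  by move=> E; rewrite -[r](subrK (e n)) E; ring.
have [rho [rho0 rho1 rhoP]] := nonresonant m1 ntri.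
have /= E0 := @solveP _ _ (fun k => \prod_i L k i i ^+ m i) e K rho
  (fun k => L_diag k j) K_gt0 (fun k => L_diag_inv k j) rho0 rho1 rhoP e_subexp n.
by move=> E; rewrite -[r](subrK (e n)) E -E0; ring.
Qed.

End Construction.

(** * From series to special triangular polynomial maps *)

Section TriangularMaps.
Variables (R : realType) (d m0 : nat) (g : fseries R d).
Implicit Types (j : 'I_d) (m : 'X_{1..d}).
Hypothesis m0_gt0 : (0 < m0)%N.
Hypothesis g_in_F : in_F g.
Hypothesis g_trig : is_trig_mx (linpart g).
Hypothesis g_diag : forall j, linpart g j j != 0.
Hypothesis g_support : forall j m,
  (1 < mdeg m)%N -> ~~ triangular_monomial m0 j m -> g j m = 0.

Lemma ftrunc_triangularK : fseries_of_polymap (ftrunc m0 g) = g.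
Proof.
apply/funext => j; apply/funext => m; rewrite /fseries_of_polymap mcoeff_ftrunc.
case: leqP => // m0m; rewrite g_support ?(leq_ltn_trans m0_gt0) //.
by rewrite /triangular_monomial leqNgt m0m.
Qed.

Lemma degree_le_ftrunc : degree_le (ftrunc m0 g) m0.
Proof.
move=> j; apply: leq_trans (msize_sum _ _ _) _; apply/bigmax_leqP => m _.
apply: leq_trans (msizeZ_le _ _) _; rewrite mmeasureX; exact: bmdeg.
Qed.

Lemma special_triangular_ftrunc : special_triangular (ftrunc m0 g).
Proof.
exists (fun j => linpart g j j), (fun j => ftrunc m0 g j - linpart g j j *: 'X_j) => j.
split=> //; first by rewrite addrC subrK.
  rewrite mcoeffB mcoeffZ mcoeffX mcoeff_ftrunc g_in_F if_same.
  case: eqP => [/(congr1 mdeg)|_]; first by rewrite mdeg1 mdeg0.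
  by rewrite mulr0 subrr.
move=> m; rewrite mcoeff_msupp mcoeffB mcoeffZ mcoeffX mcoeff_ftrunc => hm i ji.
apply/eqP; apply: contraNT hm => mi; case: leqP => [mm0|m0m]; last first.
  case: (U_(j)%MM =P m) => [jm|_]; last by rewrite mulr0 subrr.
  by move: m0m; rewrite -jm mdeg1 ltnNge m0_gt0.
have [m1|m1] := ltnP 1 (mdeg m).
  rewrite g_support // ?sub0r.
    case: (U_(j)%MM =P m) => [jm|_]; last by rewrite mulr0 oppr0.
    by move: m1; rewrite -jm mdeg1.
  by rewrite negb_and; apply/orP; right; rewrite negb_forall; apply/existsP; exists i; rewrite ji.
have /mdeg1P[k /eqP mE] : mdeg m == 1%N.
  rewrite eqn_leq m1 lt0n; apply: contraNneq mi => /eqP.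
  by rewrite mdeg_eq0 => /eqP ->; rewrite mnm0E.
move: mi; rewrite mE mnm1E eq_mnm1; case: (k =P i) => // -> _.
have [->|ij] := eqVneq j i; first by rewrite mxE mulr1 subrr.
rewrite /= mulr0 subr0; have := is_trig_mxP g_trig j i; rewrite mxE => -> //.
by rewrite ltn_neqAle ji andbT.
Qed.

End TriangularMaps.

(** * The conjugacy theorem *)

Theorem theorem3p1 (R : realType) (d : nat) (d_gt0 : (0 < d)%N)
    (f : nat -> fseries R d) (c lambda mu : R) (m0 : nat) :
  let L n : 'M[R[i]]_d := linpart (f n) in
  (forall n, in_F (f n)) ->
  subexponential f ->
  (forall n, L n \in unitmx) ->
  (forall n, is_trig_mx (L n)) ->
  0 < c -> 0 < lambda -> lambda < 1 -> 1 < mu ->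
  (forall n m, (m <= n)%N -> opnorm (mprod L n m) <= c * lambda ^+ (n - m)) ->
  (forall n m, (m <= n)%N -> opnorm (invmx (mprod L n m)) <= c * mu ^+ (n - m)) ->
  (0 < m0)%N ->
  lambda ^+ m0.+1 * mu < 1 ->
  (forall theta : R, 1 < theta -> exists2 C : R, 0 < C & forall n l : nat,
    (\big[Num.max/0]_(h < d) normc (dprod L (n + l) n h)) *
    (\big[Num.max/0]_(i < d) \big[Num.max/0]_(j < d | (i <= j)%N)
       (normc (dprod L (n + l) n j) / normc (dprod L (n + l) n i)))
      <= C * theta ^+ n * lambda ^+ l) ->
  exists (g : nat -> polymap R d) (h : nat -> fseries R d),
    [/\ subexponential (fun n => fseries_of_polymap (g n)),
        forall n, special_triangular (g n) /\ degree_le (g n) m0,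
        (forall n, in_F (h n)) /\ subexponential h,
        forall n, linpart (fseries_of_polymap (g n)) = L n /\
                  linpart (h n) = 1%:M
      & forall n, fcomp (h n.+1) (f n) =
                  fcomp (fseries_of_polymap (g n)) (h n)].
Proof.
move=> L f_in f_sub L_unit L_trig c0 lam0 lam1 mu1 L_le Linv_le m0_gt0 lam_mu diag_le.
have mu0 : 0 < mu := lt_trans ltr01 mu1.
have f_coef := subexponential_subexp f_in f_sub.
have L_diag n j : L n j j != 0 by apply: trig_unit_diag.
have K0 : 0 < c * mu by rewrite mulr_gt0.
have L_diag_inv n j : normc (L n j j)^-1 <= c * mu.
  have := dprod_inv_le L_unit L_trig Linv_le n 1 j.
  by rewrite addn1 /dprod big_nat1 expr1 normcV.
have nonres m j : (1 < mdeg m)%N -> ~~ triangular_monomial m0 j m ->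
    exists rho : R, [/\ 0 <= rho, rho < 1 & dominated (quotient L m j) rho].
  move=> m1; rewrite negb_and -ltnNge => /orP[m0m|].
    exists (lambda ^+ m0.+1 * mu); split => //.
      by rewrite mulr_ge0 ?exprn_ge0 // ltW.
    exact: (quotient_dominated_deg L_unit L_trig c0 lam0 lam1 mu0 L_le Linv_le).
  case/forallPn => i; rewrite negb_imply -lt0n => /andP[ji mi].
  exists lambda; split => //; first exact: ltW.
  exact: (quotient_dominated_var L_trig c0 lam0 lam1 L_le diag_le m1 ji mi).
pose g := normal_g m0 f; pose h := normal_h m0 f.
have g_in n := normal_g_in m0 f_in n; have h_in n := normal_h_in m0 f n.
have [sg sh] := normal_subexp f_coef K0 L_diag_inv nonres.
have gK n : fseries_of_polymap (ftrunc m0 (g n)) = g n.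
  apply: ftrunc_triangularK => // j m; exact: normal_support.
exists (fun n => ftrunc m0 (g n)), h; split.
- apply: subexp_subexponential => j m; under [X in subexp X]eq_fun => n do rewrite gK.
  exact: sg.
- move=> n; split; last exact: degree_le_ftrunc.
  have [g0 gL] := g_in n.
  apply: special_triangular_ftrunc => //.
  + rewrite gL; exact: L_trig.
  + move=> j; rewrite gL; exact: L_diag.
  + by move=> j m; apply: normal_support.
- by split; [move=> n; case: (h_in n)|apply: subexp_subexponential].
- by move=> n; rewrite gK; case: (g_in n) => _ ->; case: (h_in n) => _ ->.
move=> n; rewrite gK; apply/funext => j; apply/funext => m; apply/eqP.
have := normal_residual f_in f_coef L_trig L_diag K0 L_diag_inv nonres n j m.
by rewrite /residual => /eqP; rewrite subr_eq0.
Qed.
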